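(* Let $\mathcal{G}:(\mathbb{Z},\leq)\to\mathbf{Grp}$ be a persistence group, let $\theta=\{\theta_t\}$ be a persistent function on $\mathcal{G}$, and let $s\leq t$. Suppose that for all $h\in\mathcal{G}_s$, the condition $\theta_s(h^{-1})=\overline{\theta_s(h)}$ holds, and that $\theta_s(h)\geq0$. Then the operator $\mathcal{L}_{s,t}$ is positive semi-definite. That is, for all $f\in\mathrm{Hom}(\mathcal{G}_t,\mathbb{C})$, we have $$\langle\mathcal{L}_{s,t}f,f\rangle\geq0.$$
   Context: A persistence group is a functor $\mathcal{G}:(\mathbb{Z},\leq)\to\mathbf{Grp}$ with finite groups $\mathcal{G}_t$ and structure homomorphisms $\phi_{s,t}:\mathcal{G}_s\to\mathcal{G}_t$. $\mathrm{Hom}(\mathcal{G}_t,\mathbb{C})$ denotes the vector space of all complex-valued functions on $\mathcal{G}_t$, with inner product $\langle f,g\rangle=\sum_{x\in\mathcal{G}_t}f(x)\overline{g(x)}$. A persistent function on $\mathcal{G}$ is a family $\theta_t\in\mathrm{Hom}(\mathcal{G}_t,\mathbb{C})$ with $\theta_s=\theta_t\circ\phi_{s,t}$ for all $s\leq t$. The $(s,t)$-persistent Laplacian $\mathcal{L}_{s,t}:\mathrm{Hom}(\mathcal{G}_t,\mathbb{C})\to\mathrm{Hom}(\mathcal{G}_t,\mathbb{C})$ associated with $\theta$ is $$\mathcal{L}_{s,t}(\eta)(g)=d_s\,\eta(g)-\sum_{h\in\mathcal{G}_s}\theta_s(h)\,\eta(\phi_{s,t}(h^{-1})g),\qquad d_s=\sum_{h\in\mathcal{G}_s}\theta_s(h),\quad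 g\in\mathcal{G}_t.$$ *)

(* Defs.v *)
From HB Require Import structures.
From mathcomp Require Import all_boot all_order all_algebra all_fingroup.
From mathcomp Require Import reals complex.

Set Implicit Arguments.
Unset Strict Implicit.
Unset Printing Implicit Defensive.

Import Order.TTheory GRing.Theory Num.Theory.

Local Open Scope ring_scope.
Local Open Scope complex_scope.

(* A functor from the poset (Z, <=) to finite groups.  Since [s <= t] is a
   boolean, all its proofs are equal, so [pg_map] carries exactly one
   homomorphism for each pair s <= t. *)
Record persistenceGroup := PersistenceGroup {
  pg_obj :> int -> finGroupType;
  pg_map : forall s t : int, s <= t ->
    {morphism [set: pg_obj s] >-> pg_obj t};
  pg_map_id : forall (t : int) (le_tt : t <= t) (x : pg_obj t),
    pg_map le_tt x = x;
  pg_map_comp : forall (r s t : int) (le_rs : r <= s) (le_st : s <= t)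
      (le_rt : r <= t) (x : pg_obj r),
    pg_map le_rt x = pg_map le_st (pg_map le_rs x)
}.

Record persistentFunction (R : realType) (G : persistenceGroup) :=
  PersistentFunction {
    pf_fun :> forall t : int, {ffun G t -> R[i]};
    pf_compat : forall (s t : int) (le_st : s <= t) (x : G s),
      pf_fun s x = pf_fun t (pg_map G le_st x)
  }.

Definition inner (R : realType) (T : finType) (f g : {ffun T -> R[i]}) : R[i] :=
  \sum_(x : T) f x * ((g x)^*)%C.

Definition pdegree (R : realType) (G : persistenceGroup)
    (theta : persistentFunction R G) (s : int) : R[i] :=
  \sum_(h : G s) theta s h.

Definition plaplacian (R : realType) (G : persistenceGroup)
    (theta : persistentFunction R G) (s t : int) (le_st : s <= t)
    (eta : {ffun G t -> R[i]}) : {ffun G t -> R[i]} :=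
  [ffun g : G t => pdegree theta s * eta g
    - \sum_(h : G s) theta s h * eta (pg_map G le_st h^-1 * g)%g].

Fact plaplacian_is_linear (R : realType) (G : persistenceGroup)
    (theta : persistentFunction R G) (s t : int) (le_st : s <= t) :
  linear (plaplacian theta le_st).
Proof.
move=> a u v; apply/ffunP=> g; rewrite !ffunE.
under eq_bigr => h _ do rewrite !ffunE mulrDr mulrCA.
by rewrite big_split /= -mulr_sumr mulrDr mulrCA opprD addrACA scalerBr.
Qed.

HB.instance Definition _ (R : realType) (G : persistenceGroup)
    (theta : persistentFunction R G) (s t : int) (le_st : s <= t) :=
  GRing.isLinear.Build R[i] {ffun G t -> R[i]} {ffun G t -> R[i]} *:%R
    (plaplacian theta le_st) (plaplacian_is_linear theta le_st).

(* On R[i] the order [0 <= z] means that z is real and nonnegative. *)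
Definition positive_semidefinite (R : realType) (T : finType)
    (L : {linear {ffun T -> R[i]} -> {ffun T -> R[i]}}) : Prop :=
  forall f : {ffun T -> R[i]}, 0 <= inner (L f) f.

(* Main.v *)
Require Import Defs.
From mathcomp Require Import all_boot all_order all_algebra all_fingroup.
From mathcomp Require Import reals complex.

(** The quadratic form of the persistent Laplacian is a Dirichlet energy:
    [2 <L f, f> = \sum_h theta_s(h) ||f - f (phi(h) _)||^2], a combination of
    squared norms with nonnegative weights.

    Write [T_a f] for the translate [g |-> f (a g)].  The definition of [L]
    gives [<L f, f> = \sum_h theta_s(h) <f - T_(phi(h^-1)) f, f>].  Each summand
    taken alone need not be real.  However [theta_s] is real, so the symmetry
    hypothesis makes it invariant under inversion, and the terms of [h] and
    [h^-1] may be averaged.  Their sum is a squared norm because translations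
    are isometries ([inner_sub_translate]). *)

Set Implicit Arguments.
Unset Strict Implicit.
Unset Printing Implicit Defensive.

Import Order.TTheory GRing.Theory Num.Theory.

Local Open Scope ring_scope.
Local Open Scope complex_scope.

Lemma inner_ge0 (R : realType) (T : finType) (f : {ffun T -> R[i]}) :
  0 <= inner f f.
Proof. by apply: sumr_ge0 => x _; exact: mul_conjC_ge0. Qed.

Lemma innerBr (R : realType) (T : finType) (f g h : {ffun T -> R[i]}) :
  inner f (g - h) = inner f g - inner f h.
Proof.
rewrite /inner -sumrB; apply: eq_bigr => x _.
by rewrite !ffunE rmorphB mulrBr.
Qed.

Lemma innerNl (R : realType) (T : finType) (f g : {ffun T -> R[i]}) :
  inner (- f) g = - inner f g.
Proof. by rewrite /inner -sumrN; apply: eq_bigr => x _; rewrite ffunE mulNr. Qed.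

Definition translate (R : realType) (gT : finGroupType) (a : gT)
    (f : {ffun gT -> R[i]}) : {ffun gT -> R[i]} :=
  [ffun g => f (a * g)%g].

Lemma inner_translate (R : realType) (gT : finGroupType) (a : gT)
    (f g : {ffun gT -> R[i]}) :
  inner (translate a f) (translate a g) = inner f g.
Proof.
rewrite [RHS](reindex_inj (mulgI a)).
by apply: eq_bigr => x _; rewrite !ffunE.
Qed.

(** Expanding the right argument of the squared norm leaves the term
    [<T_a f - f, T_a f>], which the isometry [T_(a^-1)] carries to
    [<f - T_(a^-1) f, f>]. *)
Lemma inner_sub_translate (R : realType) (gT : finGroupType) (a : gT)
    (f : {ffun gT -> R[i]}) :
  inner (f - translate a f) f + inner (f - translate a^-1%g f) f =
  inner (f - translate a f) (f - translate a f).
Proof.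
rewrite innerBr; congr (_ + _).
rewrite -innerNl opprB -(inner_translate a^-1%g (translate a f - f)).
by congr inner; apply/ffunP=> g; rewrite !ffunE mulKVg.
Qed.

Lemma inner_plaplacian (R : realType) (G : persistenceGroup)
    (theta : persistentFunction R G) (s t : int) (le_st : s <= t)
    (f : {ffun G t -> R[i]}) :
  inner (plaplacian theta le_st f) f =
  \sum_(h : G s) theta s h * inner (f - translate (pg_map G le_st h^-1%g) f) f.
Proof.
under [RHS]eq_bigr => h _ do rewrite mulr_sumr.
rewrite exchange_big; apply: eq_bigr => g _ /=.
rewrite ffunE /pdegree mulr_suml -sumrB mulr_suml; apply: eq_bigr => h _.
by rewrite !ffunE -mulrBr mulrA.
Qed.

Theorem proposition3p2p9 (R : realType) (G : persistenceGroup)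
    (theta : persistentFunction R G) (s t : int) (le_st : s <= t)
    (theta_conj : forall h : G s, theta s (h^-1)%g = (theta s h)^*)
    (theta_ge0 : forall h : G s, 0 <= theta s h) :
  positive_semidefinite (plaplacian theta le_st).
Proof.
move=> f; rewrite /= inner_plaplacian; set S := \sum_h _.
have thetaV h : theta s h^-1%g = theta s h.
  by rewrite theta_conj; exact: (CrealP (ger0_real (theta_ge0 h))).
(* Inverting the summation index turns the same sum into one over [phi(h)]. *)
have SV : S = \sum_(h : G s) theta s h
                * inner (f - translate (pg_map G le_st h) f) f.
  rewrite /S (reindex_inj invg_inj) /=.
  by apply: eq_bigr => h _; rewrite thetaV invgK.
rewrite -(pmulrn_lge0 _ (ltn0Sn 1)) mulr2n {1}SV -big_split /=.
apply: sumr_ge0 => h _.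
rewrite -mulrDr morphV ?inE // inner_sub_translate.
by rewrite mulr_ge0 // inner_ge0.
Qed.
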